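(* Let $m\ge4$ be even, $j_0=(m-2)/2$, and let $\mathcal K=\mathcal K^{(m)}_{D_h}$ and $\mathcal H=\mathcal H^{(m)}_{D_h}$ be the local curvature functions given explicitly in the context. Define, for real $s,t$ (removable singularities filled in by continuity), with $f_1(x)=(e^x-1)/x$, $$K_{\mathrm{EH}}(s)=-8j_0\frac{\sinh(s/4)}{s}\mathcal K(s),\qquad H_{\mathrm{EH}}(s,t)=-8j_0\frac{\sinh((s+t)/4)}{s+t}\mathcal H(s,t),$$ $$T(s)=2j_0\,\mathcal K(0)f_1(-j_0s)+\mathcal H(s,-s),\qquad \tilde T(s)=T(-s)e^{-j_0s},$$ $$L(s,t)=-2j_0\,T(s)\,f_1(-j_0(s+t)),$$ $$M(s,t)=2e^{-j_0(s+t)}\left[\frac{T(-t)-T(s)}{s+t}+\frac{T(t)-T(-s)}{s+t}e^{j_0t}\right],$$ $$P(s,t)=-2j_0f_1(-j_0s)T(t)-2\frac{T(s+t)-T(t)}{s}+2\frac{T(s+t)-T(s)}{t},$$ $$Q(s,t)=-2j_0f_1(-j_0s)\tilde T(t)-2\frac{\tilde T(s+t)-\tilde T(t)}{s}+2\frac{\tilde T(s+t)-\tilde T(s)}{t}.$$ Then $$K_{\mathrm{EH}}(s)=-(T+\tilde T)(s),\qquad H_{\mathrm{EH}}(s,t)=(L+M-P-Q)(s,t).$$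
   Context: The local curvature functions are $$\mathcal K^{(m)}_{D_h}(s)=e^{s/4}K^{(m)}_{\Delta_k}(e^s)f_1(s/2),$$ $$\mathcal H^{(m)}_{D_h}(s,t)=e^{(s+t)/4}\Big(e^{s/2}H^{(m)}_{\Delta_k}(e^s,e^t)f_1(s/2)f_1(t/2)+2g_2(s/2,t/2)K^{(m)}_{\Delta_k}(e^{s+t})\Big),$$ where $f_1(x)=\frac{e^x-1}{x}$, $g_2(x,y)=\frac{f_1(x+y)-f_1(x)}{y}$ and, for $s,t>0$, $$K^{(m)}_{\Delta_k}(s)=\frac{d^{(m-4)/2}}{du^{(m-4)/2}}\Big|_{u=0}F(u,s,m),\qquad H^{(m)}_{\Delta_k}(s,t)=\frac{d^{(m-4)/2}}{du^{(m-4)/2}}\Big|_{u=0}G(u,s,t,m),$$ $$F(u,s,m)=\frac{m(\sqrt s+1)(u-1)+2(2\sqrt s+u+1)}{m(u-1)^3(u-s)},\qquad G(u,s,t,m)=\frac{N(u,s,t,m)}{m(u-1)^3(u-s)^2(u-st)},$$ \begin{align*} N={}&s^{3/2}\big(m((2\sqrt s+1)\sqrt t+2)-4((2\sqrt s+1)\sqrt t+1)\big)\\ &+u^2\big(2(s+2\sqrt s+3)(\sqrt s\sqrt t+1)-m(s^{3/2}\sqrt t-2s(\sqrt t-1)-2\sqrt s+2)\big)\\ &-u\sqrt s\big[s(6\sqrt t+4)+\sqrt s(10-4\sqrt t)-2(\sqrt t+1)+m(2s^{3/2}\sqrt t+2\sqrt s(\sqrt t-1)+2s+\sqrt t+2)\big]\\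 &+u^3\big(m\sqrt s\sqrt t+2m+2\sqrt s+2\big). \end{align*} For example, for $m=4$: $K^{(4)}_{\Delta_k}(s)=-\frac1{2s}$ and $H^{(4)}_{\Delta_k}(s,t)=\frac{1}{s^{3/2}t}$. Origin of the functions: if ${\not\!\!D}$ is the spinor Dirac operator and $D_h=e^{h/2}{\not\!\!D}e^{h/2}$ is the conformally perturbed Dirac operator on an even $m$-dimensional Connes–Landi noncommutative spin manifold, then $\mathcal K^{(m)}_{D_h}$ and $\mathcal H^{(m)}_{D_h}$ are the one- and two-variable functions of the modular derivation $-2\,\mathrm{ad}_h$ occurring in the density of the second heat coefficient of $D_h^2$. The identities claimed are identities between explicit functions. *)

(* Defs.v *)
From Stdlib Require Import Reals Arith ClassicalEpsilon.
From Coquelicot Require Import Coquelicot.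

Open Scope R_scope.

(** [fill D f] is [f] on its natural domain [D]; at a point outside [D] it is
    the limit of [f] along [D] (for [X = R * R], the joint limit in both
    variables). *)
Definition fill {X : UniformSpace} (D : X -> Prop) (f : X -> R) (x : X) : R :=
  if excluded_middle_informative (D x) then f x
  else iota (fun l : R => filterlim f (within D (locally x)) (locally l)).

Definition f1 (x : R) : R :=
  fill (fun x : R => x <> 0) (fun x : R => (exp x - 1) / x) x.

Definition g2 (x y : R) : R :=
  fill (fun p : R * R => snd p <> 0)
       (fun p : R * R => (f1 (fst p + snd p) - f1 (fst p)) / snd p) (x, y).

Definition F (m : nat) (u s : R) : R :=
  (INR m * (sqrt s + 1) * (u - 1) + 2 * (2 * sqrt s + u + 1))
  / (INR m * (u - 1) ^ 3 * (u - s)).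

Definition G_num (m : nat) (u s t : R) : R :=
  Rpower s (3 / 2)
    * (INR m * ((2 * sqrt s + 1) * sqrt t + 2)
       - 4 * ((2 * sqrt s + 1) * sqrt t + 1))
  + u ^ 2
    * (2 * (s + 2 * sqrt s + 3) * (sqrt s * sqrt t + 1)
       - INR m * (Rpower s (3 / 2) * sqrt t - 2 * s * (sqrt t - 1)
                  - 2 * sqrt s + 2))
  - u * sqrt s
    * (s * (6 * sqrt t + 4) + sqrt s * (10 - 4 * sqrt t) - 2 * (sqrt t + 1)
       + INR m * (2 * Rpower s (3 / 2) * sqrt t + 2 * sqrt s * (sqrt t - 1)
                  + 2 * s + sqrt t + 2))
  + u ^ 3 * (INR m * sqrt s * sqrt t + 2 * INR m + 2 * sqrt s + 2).

Definition G (m : nat) (u s t : R) : R :=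
  G_num m u s t / (INR m * (u - 1) ^ 3 * (u - s) ^ 2 * (u - s * t)).

(** Meaningful for [0 < s] and [0 < t], and for [m] even with [4 <= m], so that
    the truncated operations on [nat] are exact. *)
Definition K_Delta (m : nat) (s : R) : R :=
  Derive_n (fun u => F m u s) ((m - 4) / 2)%nat 0.

Definition H_Delta (m : nat) (s t : R) : R :=
  Derive_n (fun u => G m u s t) ((m - 4) / 2)%nat 0.

Definition K_D (m : nat) (s : R) : R :=
  exp (s / 4) * K_Delta m (exp s) * f1 (s / 2).

Definition H_D (m : nat) (s t : R) : R :=
  exp ((s + t) / 4)
  * (exp (s / 2) * H_Delta m (exp s) (exp t) * f1 (s / 2) * f1 (t / 2)
     + 2 * g2 (s / 2) (t / 2) * K_Delta m (exp (s + t))).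

Definition j0 (m : nat) : R := (INR m - 2) / 2.

Definition K_EH (m : nat) (s : R) : R :=
  fill (fun s : R => s <> 0)
       (fun s : R => - 8 * j0 m * (sinh (s / 4) / s) * K_D m s) s.

Definition H_EH (m : nat) (s t : R) : R :=
  fill (fun p : R * R => fst p + snd p <> 0)
       (fun p : R * R => let (s, t) := p in
          - 8 * j0 m * (sinh ((s + t) / 4) / (s + t)) * H_D m s t) (s, t).

Definition T (m : nat) (s : R) : R :=
  2 * j0 m * K_D m 0 * f1 (- j0 m * s) + H_D m s (- s).

Definition Ttilde (m : nat) (s : R) : R := T m (- s) * exp (- j0 m * s).

Definition L (m : nat) (s t : R) : R :=
  - 2 * j0 m * T m s * f1 (- j0 m * (s + t)).

Definition M (m : nat) (s t : R) : R :=
  fill (fun p : R * R => fst p + snd p <> 0)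
       (fun p : R * R => let (s, t) := p in
          2 * exp (- j0 m * (s + t))
          * ((T m (- t) - T m s) / (s + t)
             + (T m t - T m (- s)) / (s + t) * exp (j0 m * t))) (s, t).

Definition P (m : nat) (s t : R) : R :=
  fill (fun p : R * R => fst p <> 0 /\ snd p <> 0)
       (fun p : R * R => let (s, t) := p in
          - 2 * j0 m * f1 (- j0 m * s) * T m t
          - 2 * ((T m (s + t) - T m t) / s)
          + 2 * ((T m (s + t) - T m s) / t)) (s, t).

Definition Q (m : nat) (s t : R) : R :=
  fill (fun p : R * R => fst p <> 0 /\ snd p <> 0)
       (fun p : R * R => let (s, t) := p in
          - 2 * j0 m * f1 (- j0 m * s) * Ttilde m t
          - 2 * ((Ttilde m (s + t) - Ttilde m t) / s)
          + 2 * ((Ttilde m (s + t) - Ttilde m s) / t)) (s, t).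

(* Main.v *)
Require Import Defs.
From Stdlib Require Import Reals Arith Lra Lia FunctionalExtensionality ClassicalEpsilon.
From Coquelicot Require Import Coquelicot.

(** Write [y = e^(s/2)], [z = e^(t/2)], [n = (m-4)/2], [j0 = n + 1]. For [s], [t], [s + t]
    nonzero, the two identities reduce to linear relations between values of [K_Delta] and
    [H_Delta]. Such a relation says that the n-th Taylor coefficient at [u = 0] of a
    combination [D] of the rational functions [F], [G] vanishes; the factor [e^(-j0 s)] is
    absorbed by the substitution [u -> u / y^2]. In both cases [D = u W' - n W] for an explicit
    rational function [W], and the n-th coefficient of [u W' - n W] is [(n - n) w_n = 0].

    The remaining [s], [t] follow by density once both sides are known to be continuous. The
    Taylor coefficients of [F] and [G] are finite sums of products of exponentials in [s], [t],
    so [T] is smooth enough for its difference quotients, which are what is filled in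
    inside [M], [P], [Q], to extend continuously. *)

(** * Taylor expansions at the origin *)

(** Convergence to [f] on a whole neighbourhood of 0, so that [c] is unique and determines all
    derivatives of [f] at 0. *)
Definition taylor (f : R -> R) (c : nat -> R) : Prop :=
  locally 0 (fun u => is_pseries c u (f u)).

Lemma locally_Rabs_lt (x : R) (P : R -> Prop) :
  locally x P <-> exists r, 0 < r /\ forall u, Rabs (u - x) < r -> P u.
Proof.
  split.
  - intros [r Hr]. exists r. split; [apply cond_pos|]. exact Hr.
  - intros (r & Hr & H). exists (mkposreal r Hr). exact H.
Qed.

(** The terms of a convergent series tend to 0, which fails outside the disc of convergence. *)
Lemma CV_radius_ge (c : nat -> R) (r : R) :
  ex_pseries c r -> Rbar_le (Rabs r) (CV_radius c).
Proof.
  intros [l H]. apply Rbar_not_lt_le. intros Hlt. apply (CV_disk_outside _ _ Hlt).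
  apply ex_series_lim_0. exists l. now apply is_pseries_R.
Qed.

Lemma taylor_radius (f : R -> R) (c : nat -> R) :
  taylor f c -> locally 0 (fun u => Rbar_lt (Rabs u) (CV_radius c)).
Proof.
  intros H. apply locally_Rabs_lt in H. destruct H as (r & Hr & H).
  apply locally_Rabs_lt. exists (r / 2). split; [lra|]. intros u Hu.
  rewrite Rminus_0_r in Hu.
  apply Rbar_lt_le_trans with (Rabs (r / 2)).
  { simpl. rewrite (Rabs_pos_eq (r / 2)); lra. }
  apply CV_radius_ge. exists (f (r / 2)). apply H.
  rewrite Rminus_0_r, Rabs_pos_eq; lra.
Qed.

Lemma taylor_radius_pos (f : R -> R) (c : nat -> R) :
  taylor f c -> Rbar_lt 0 (CV_radius c).
Proof.
  intros H. apply taylor_radius in H. apply locally_singleton in H.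
  now rewrite Rabs_R0 in H.
Qed.

Lemma taylor_PSeries (f : R -> R) (c : nat -> R) :
  taylor f c -> locally 0 (fun u => f u = PSeries c u).
Proof.
  unfold taylor. apply filter_imp. intros u Hu. symmetry. now apply is_pseries_unique.
Qed.

Lemma taylor_unique (f g : R -> R) (c d : nat -> R) (n : nat) :
  taylor f c -> taylor g d -> locally 0 (fun u => f u = g u) -> c n = d n.
Proof.
  intros Hf Hg Hfg. apply PSeries_ext_recip.
  - now apply taylor_radius_pos in Hf.
  - now apply taylor_radius_pos in Hg.
  - apply taylor_PSeries in Hf, Hg. generalize (filter_and _ _ Hf (filter_and _ _ Hg Hfg)).
    apply filter_imp. intros u (H1 & H2 & H3). congruence.
Qed.

Lemma taylor_Derive_n (f : R -> R) (c : nat -> R) (n : nat) :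
  taylor f c -> Derive_n f n 0 = INR (fact n) * c n.
Proof.
  intros H. rewrite Rmult_comm, <- Derive_n_coef.
  - apply Derive_n_ext_loc. now apply taylor_PSeries.
  - now apply taylor_radius_pos in H.
Qed.

Lemma taylor_ext (f g : R -> R) (c d : nat -> R) :
  (forall u, f u = g u) -> (forall n, c n = d n) -> taylor f c -> taylor g d.
Proof.
  intros H H'. unfold taylor. apply filter_imp. intros u Hu. rewrite <- H.
  now apply is_pseries_ext with c.
Qed.

Lemma taylor_const (a : R) : taylor (fun _ => a) (fun n => match n with O => a | _ => 0 end).
Proof.
  unfold taylor. apply filter_forall. intros u. apply is_pseries_R.
  (* Past the zeroth term all partial sums vanish. *)
  apply is_series_decr_1. simpl. rewrite Rmult_1_r.
  unfold plus, opp. simpl. rewrite Rplus_opp_r.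
  apply filterlim_ext with (fun _ => 0); [|apply filterlim_const].
  intros n. symmetry. induction n as [|n IH].
  - rewrite sum_O. ring.
  - rewrite sum_Sn, IH. unfold plus. simpl. ring.
Qed.

Lemma taylor_plus (f g : R -> R) (c d : nat -> R) :
  taylor f c -> taylor g d -> taylor (fun u => f u + g u) (fun n => c n + d n).
Proof.
  intros Hf Hg. generalize (filter_and _ _ Hf Hg).
  unfold taylor. apply filter_imp.
  intros u [H1 H2]. exact (is_pseries_plus _ _ _ _ _ H1 H2).
Qed.

Lemma taylor_scal (a : R) (f : R -> R) (c : nat -> R) :
  taylor f c -> taylor (fun u => a * f u) (fun n => a * c n).
Proof.
  unfold taylor. apply filter_imp. intros u Hu. apply (is_pseries_scal a c u (f u)); trivial.
  apply Rmult_comm.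
Qed.

Lemma taylor_mult (f g : R -> R) (c d : nat -> R) :
  taylor f c -> taylor g d -> taylor (fun u => f u * g u) (PS_mult c d).
Proof.
  intros Hf Hg.
  generalize (filter_and _ _ (filter_and _ _ Hf Hg)
    (filter_and _ _ (taylor_radius _ _ Hf) (taylor_radius _ _ Hg))).
  unfold taylor. apply filter_imp. intros u [[H1 H2] [H3 H4]]. now apply is_pseries_mult.
Qed.

Lemma taylor_mult_id (f : R -> R) (c : nat -> R) :
  taylor f c -> taylor (fun u => u * f u) (PS_incr_1 c).
Proof.
  unfold taylor. apply filter_imp. intros u Hu. exact (is_pseries_incr_1 _ _ _ Hu).
Qed.

Lemma taylor_comp_scal (a : R) (f : R -> R) (c : nat -> R) :
  taylor f c -> taylor (fun u => f (a * u)) (fun n => a ^ n * c n).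
Proof.
  intros H. apply locally_Rabs_lt in H. destruct H as (r & Hr & H).
  assert (Ha := Rabs_pos a).
  (* The [+ 1] covers the case [a = 0]. *)
  apply locally_Rabs_lt. exists (r / (Rabs a + 1)). split.
  { apply Rdiv_lt_0_compat; lra. }
  intros u Hu. rewrite Rminus_0_r in Hu.
  assert (Hau : Rabs (a * u - 0) < r).
  { rewrite Rminus_0_r, Rabs_mult. apply Rle_lt_trans with ((Rabs a + 1) * Rabs u).
    - apply Rmult_le_compat_r; [apply Rabs_pos | lra].
    - apply Rmult_lt_compat_l with (r := Rabs a + 1) in Hu; [|lra].
      replace ((Rabs a + 1) * (r / (Rabs a + 1))) with r in Hu by (field; lra).
      exact Hu. }
  apply H, is_pseries_R in Hau. apply is_pseries_R.
  revert Hau. apply is_series_ext. intros n. rewrite Rpow_mult_distr. simpl. ring.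
Qed.

(** The geometric series, with [u] rescaled by [/ a] and the sum by [- / a]. *)
Lemma taylor_inv_sub (a : R) :
  a <> 0 -> taylor (fun u => / (u - a)) (fun n => - (/ a) ^ S n).
Proof.
  intros Ha.
  assert (H : taylor (fun u => / (1 - u)) (fun _ => 1)).
  { apply locally_Rabs_lt. exists 1. split; [lra|]. intros u Hu.
    rewrite Rminus_0_r in Hu. apply is_pseries_R.
    generalize (is_series_geom u Hu). apply is_series_ext. intros n. simpl. ring. }
  apply (taylor_comp_scal (/ a)) in H. apply (taylor_scal (- / a)) in H.
  revert H. apply taylor_ext.
  - intros u. rewrite <- Ropp_mult_distr_l, <- Rinv_mult.
    replace (a * (1 - / a * u)) with (- (u - a)) by (field; trivial).
    rewrite Rinv_opp. ring.
  - intros n. simpl. ring.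
Qed.

(** Termwise differentiation shifts the coefficients down with a factor [n], and multiplication by
    [u] shifts them back. *)
Lemma taylor_euler (f g : R -> R) (c : nat -> R) :
  taylor f c -> locally 0 (fun u => is_derive f u (g u)) ->
  taylor (fun u => u * g u) (fun n => INR n * c n).
Proof.
  intros Hf Hd.
  assert (H : taylor g (PS_derive c)).
  { generalize (filter_and _ _ (filter_and _ _ Hd (taylor_radius _ _ Hf))
      (locally_locally _ _ (taylor_PSeries _ _ Hf))).
    unfold taylor. apply filter_imp. intros u [[H1 H2] H3].
    replace (g u) with (Derive (PSeries c) u); [now apply is_pseries_derive|].
    rewrite <- (is_derive_unique _ _ _ H1). symmetry. now apply Derive_ext_loc. }
  apply taylor_mult_id in H. revert H. apply taylor_ext; trivial.
  intros [|n]; [|reflexivity]. change (0 = 0 * c O). ring.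
Qed.

(** * Taylor expansions depending on parameters *)

Record exp_algebra {X : Type} (C : (X -> R) -> Prop) : Prop := {
  alg_const : forall a, C (fun _ => a);
  alg_plus : forall f g, C f -> C g -> C (fun x => f x + g x);
  alg_mult : forall f g, C f -> C g -> C (fun x => f x * g x);
  alg_exp : forall f, C f -> C (fun x => exp (f x)) }.

(** Three choices of [C] are made: all functions, for the mere existence of expansions; continuous
    functions and functions with a slope, for the regularity of [K_Delta] and [H_Delta] along
    exponentials. *)
Definition taylor_family {X : Type} (C : (X -> R) -> Prop) (f : X -> R -> R) : Prop :=
  exists c, (forall x, taylor (f x) (c x)) /\ (forall n, C (fun x => c x n)).

Section TaylorFamily.

Context {X : Type} (C : (X -> R) -> Prop) (HC : exp_algebra C).

Lemma alg_sum (f : nat -> X -> R) (n : nat) :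
  (forall k, C (f k)) -> C (fun x => sum_f_R0 (fun k => f k x) n).
Proof.
  intros H. induction n as [|n IH]; simpl; [apply H|]. now apply alg_plus.
Qed.

Lemma alg_pow (f : X -> R) (n : nat) : C f -> C (fun x => f x ^ n).
Proof.
  intros H. induction n as [|n IH]; simpl; [now apply alg_const | now apply alg_mult].
Qed.

Lemma family_const (f : X -> R) : C f -> taylor_family C (fun x _ => f x).
Proof.
  intros H. eexists. split; [intros x; apply taylor_const|].
  intros [|n]; trivial. now apply alg_const.
Qed.

Lemma family_plus (f g : X -> R -> R) :
  taylor_family C f -> taylor_family C g -> taylor_family C (fun x u => f x u + g x u).
Proof.
  intros (c & Hc & Hc') (d & Hd & Hd'). eexists. split; [intros x; now apply taylor_plus|].
  intros n. now apply alg_plus.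
Qed.

Lemma family_mult (f g : X -> R -> R) :
  taylor_family C f -> taylor_family C g -> taylor_family C (fun x u => f x u * g x u).
Proof.
  intros (c & Hc & Hc') (d & Hd & Hd'). eexists. split; [intros x; now apply taylor_mult|].
  intros n. unfold PS_mult. apply (alg_sum (fun k x => c x k * d x (n - k)%nat)).
  intros k. now apply alg_mult.
Qed.

Lemma family_id : taylor_family C (fun _ u => u).
Proof.
  destruct (family_const (fun _ => 1) (alg_const _ HC 1)) as (c & Hc & Hc').
  exists (fun x => PS_incr_1 (c x)). split.
  - intros x. apply (taylor_ext (fun u => u * 1) _ (PS_incr_1 (c x))); trivial.
    + intros u. ring.
    + now apply taylor_mult_id.
  - intros [|n]; simpl; [now apply alg_const | apply Hc'].
Qed.

Lemma family_pow (f : X -> R -> R) (n : nat) :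
  taylor_family C f -> taylor_family C (fun x u => f x u ^ n).
Proof.
  intros H. induction n as [|n IH]; simpl.
  - apply (family_const (fun _ => 1)). now apply alg_const.
  - now apply family_mult.
Qed.

(** A pole written as an exponential stays away from 0, and its inverse [exp (- f x)] is again in
    [C], although [C] is not assumed closed under inverses. *)
Lemma family_inv_sub_exp (f : X -> R) :
  C f -> taylor_family C (fun x u => / (u - exp (f x))).
Proof.
  intros H. eexists. split.
  - intros x. apply taylor_inv_sub. apply Rgt_not_eq, exp_pos.
  - intros n. cbv beta. replace (fun x => - (/ exp (f x)) ^ S n)
      with (fun x => -1 * exp (-1 * f x) ^ S n).
    + apply (alg_mult _ HC (fun _ => -1)); [now apply alg_const|].
      apply (alg_pow (fun x => exp (-1 * f x))). apply (alg_exp _ HC).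
      apply (alg_mult _ HC (fun _ => -1)); trivial. now apply alg_const.
    + apply functional_extensionality. intros x.
      rewrite <- exp_Ropp. replace (-1 * f x) with (- f x) by ring. ring.
Qed.

Lemma family_Derive_n (f : X -> R -> R) (n : nat) :
  taylor_family C f -> C (fun x => Derive_n (f x) n 0).
Proof.
  intros (c & Hc & Hc').
  replace (fun x => Derive_n (f x) n 0) with (fun x => INR (fact n) * c x n).
  - apply (alg_mult _ HC (fun _ => INR (fact n)) (fun x => c x n)); trivial.
    now apply alg_const.
  - apply functional_extensionality. intros x. symmetry. now apply taylor_Derive_n.
Qed.

End TaylorFamily.

(** * Taylor expansions of F and G *)

Lemma exp_half_pow2 (x : R) : exp (x / 2) ^ 2 = exp x.
Proof.
  replace x with (x / 2 + x / 2) at 2 by lra. rewrite exp_plus. ring.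
Qed.

Lemma Rpower_sqr_3_2 (y : R) : 0 < y -> Rpower (y ^ 2) (3 / 2) = y ^ 3.
Proof.
  intros Hy. rewrite <- (Rpower_pow 2), <- (Rpower_pow 3), Rpower_mult by trivial.
  f_equal. simpl. lra.
Qed.

(** Evaluation at squares removes the roots and leaves a function rational in [u] and [y]; [G_sqr]
    does the same for [G]. *)
Lemma F_sqr (m : nat) (u y : R) : 0 < y ->
  F m u (y ^ 2) = (INR m * (y + 1) * (u - 1) + 2 * (2 * y + u + 1))
                  / (INR m * (u - 1) ^ 3 * (u - y ^ 2)).
Proof.
  intros Hy. unfold F. rewrite sqrt_pow2; lra.
Qed.

Lemma G_sqr (m : nat) (u y z : R) : 0 < y -> 0 < z ->
  G m u (y ^ 2) (z ^ 2) =
  (y ^ 3 * (INR m * ((2 * y + 1) * z + 2) - 4 * ((2 * y + 1) * z + 1))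
   + u ^ 2
     * (2 * (y ^ 2 + 2 * y + 3) * (y * z + 1)
        - INR m * (y ^ 3 * z - 2 * y ^ 2 * (z - 1) - 2 * y + 2))
   - u * y
     * (y ^ 2 * (6 * z + 4) + y * (10 - 4 * z) - 2 * (z + 1)
        + INR m * (2 * y ^ 3 * z + 2 * y * (z - 1) + 2 * y ^ 2 + z + 2))
   + u ^ 3 * (INR m * y * z + 2 * INR m + 2 * y + 2))
  / (INR m * (u - 1) ^ 3 * (u - y ^ 2) ^ 2 * (u - (y * z) ^ 2)).
Proof.
  intros Hy Hz. unfold G, G_num.
  rewrite !sqrt_pow2, Rpower_sqr_3_2, Rpow_mult_distr by lra. reflexivity.
Qed.

Section Families.

Context {X : Type} (C : (X -> R) -> Prop) (HC : exp_algebra C).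

Ltac alg :=
  lazymatch goal with
  | |- C (fun _ => ?a) => exact (alg_const C HC a)
  | |- C (fun x => @?f x + @?g x) => apply (alg_plus C HC f g); alg
  | |- C (fun x => @?f x * @?g x) => apply (alg_mult C HC f g); alg
  | |- C (fun x => @?f x ^ ?n) => apply (alg_pow C HC f n); alg
  | |- C (fun x => exp (@?f x)) => apply (alg_exp C HC f); alg
  | |- C _ => assumption
  end.

Ltac family :=
  lazymatch goal with
  | |- taylor_family C (fun x _ => @?f x) => apply (family_const C HC f); cbv beta; alg
  | |- taylor_family C (fun _ u => u) => exact (family_id C HC)
  | |- taylor_family C (fun x u => @?f x u + @?g x u) =>
      apply (family_plus C HC f g); family
  | |- taylor_family C (fun x u => @?f x u * @?g x u) =>
      apply (family_mult C HC f g); family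
  | |- taylor_family C (fun x u => @?f x u ^ ?n) => apply (family_pow C HC f n); family
  | |- taylor_family C (fun x u => / (u - exp (@?f x))) =>
      apply (family_inv_sub_exp C HC f); alg
  end.

Lemma family_F (m : nat) (a : X -> R) :
  C a -> taylor_family C (fun x u => F m u (exp (a x))).
Proof.
  intros Ha.
  (* Only the shapes recognised by [family] occur here; [exp 0] is the pole at 1. The equality holds
     even at poles, since the total inverse with [/ 0 = 0] is multiplicative. *)
  replace (fun x u => F m u (exp (a x))) with (fun x u =>
    (INR m * (exp (a x * / 2) + 1) * (u + -1) + 2 * (2 * exp (a x * / 2) + u + 1))
    * (/ INR m * (/ (u - exp 0)) ^ 3 * / (u - exp (a x)))).
  - family.
  - extensionality x. extensionality u.
    rewrite <- (exp_half_pow2 (a x)), F_sqr by apply exp_pos.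
    rewrite exp_0. unfold Rdiv. rewrite !Rinv_mult, pow_inv. reflexivity.
Qed.

Lemma family_G (m : nat) (a b : X -> R) :
  C a -> C b -> taylor_family C (fun x u => G m u (exp (a x)) (exp (b x))).
Proof.
  intros Ha Hb.
  replace (fun x u => G m u (exp (a x)) (exp (b x))) with (fun x u =>
    let y := exp (a x * / 2) in
    let z := exp (b x * / 2) in
    (y ^ 3 * (INR m * ((2 * y + 1) * z + 2) + -4 * ((2 * y + 1) * z + 1))
     + u ^ 2
       * (2 * (y ^ 2 + 2 * y + 3) * (y * z + 1)
          + -1 * (INR m * (y ^ 3 * z + -2 * y ^ 2 * (z + -1) + -2 * y + 2)))
     + -1 * (u * y
       * (y ^ 2 * (6 * z + 4) + y * (10 + -4 * z) + -2 * (z + 1)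
          + INR m * (2 * y ^ 3 * z + 2 * y * (z + -1) + 2 * y ^ 2 + z + 2)))
     + u ^ 3 * (INR m * y * z + 2 * INR m + 2 * y + 2))
    * (/ INR m * (/ (u - exp 0)) ^ 3 * (/ (u - exp (a x))) ^ 2
       * / (u - exp (a x + b x)))).
  - cbv zeta. family.
  - extensionality x. extensionality u. cbv zeta.
    replace (exp (a x + b x)) with ((exp (a x / 2) * exp (b x / 2)) ^ 2).
    2: { rewrite Rpow_mult_distr, !exp_half_pow2. symmetry. apply exp_plus. }
    rewrite <- (exp_half_pow2 (a x)), <- (exp_half_pow2 (b x)).
    rewrite G_sqr by apply exp_pos. rewrite exp_0. unfold Rdiv.
    rewrite !Rinv_mult, !pow_inv. ring.
Qed.

Lemma alg_K_Delta (m : nat) (a : X -> R) :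
  C a -> C (fun x => K_Delta m (exp (a x))).
Proof.
  intros Ha. apply (family_Derive_n C HC (fun x u => F m u (exp (a x)))).
  now apply family_F.
Qed.

Lemma alg_H_Delta (m : nat) (a b : X -> R) :
  C a -> C b -> C (fun x => H_Delta m (exp (a x)) (exp (b x))).
Proof.
  intros Ha Hb. apply (family_Derive_n C HC (fun x u => G m u (exp (a x)) (exp (b x)))).
  now apply family_G.
Qed.

End Families.

Lemma exp_algebra_True (X : Type) : @exp_algebra X (fun _ => True).
Proof. now constructor. Qed.

Lemma F_taylor (m : nat) (s : R) :
  0 < s -> exists c, taylor (fun u => F m u s) c.
Proof.
  intros Hs. destruct (family_F _ (exp_algebra_True unit) m (fun _ => ln s) I) as (c & Hc & _).
  exists (c tt). rewrite <- (exp_ln s) by trivial. exact (Hc tt).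
Qed.

Lemma G_taylor (m : nat) (s t : R) :
  0 < s -> 0 < t -> exists c, taylor (fun u => G m u s t) c.
Proof.
  intros Hs Ht.
  destruct (family_G _ (exp_algebra_True unit) m (fun _ => ln s) (fun _ => ln t) I I)
    as (c & Hc & _).
  exists (c tt). rewrite <- (exp_ln s), <- (exp_ln t) by trivial. exact (Hc tt).
Qed.

Lemma locally_0_neq (p : R) : p <> 0 -> locally 0 (fun u => u - p <> 0).
Proof.
  intros Hp. apply locally_Rabs_lt. exists (Rabs p). split; [now apply Rabs_pos_lt|].
  intros u Hu E. rewrite Rminus_0_r in Hu. replace u with p in Hu by lra. lra.
Qed.

(** * Relations between K_Delta and H_Delta *)

Lemma inv_pow_taylor (p : R) (k : nat) :
  p <> 0 -> exists c, taylor (fun u => (/ (u - p)) ^ k) c.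
Proof.
  intros Hp. induction k as [|k [c IH]]; simpl.
  - eexists. apply (taylor_const 1).
  - eexists. apply (taylor_mult _ _ _ _ (taylor_inv_sub p Hp) IH).
Qed.

(** With [W = (/ (u - p)) ^ k] this function is [u W' - n W], whose [n]-th coefficient is
    [n w_n - n w_n]. *)
Lemma inv_pow_euler_sub (n k : nat) (p : R) :
  p <> 0 ->
  exists d, taylor (fun u => - INR k * u * (/ (u - p)) ^ S k - INR n * (/ (u - p)) ^ k) d
            /\ d n = 0.
Proof.
  intros Hp. destruct (inv_pow_taylor p k Hp) as [c Hc].
  assert (Hd : locally 0 (fun u => is_derive (fun u => (/ (u - p)) ^ k) u
                                     (- INR k * (/ (u - p)) ^ S k))).
  { generalize (locally_0_neq p Hp). apply filter_imp. intros u Hu.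
    (* The computed derivative carries the exponent [pred k], hence the separate case [k = 0]. *)
    auto_derive; trivial. destruct k as [|k]; simpl pred.
    - simpl. ring.
    - generalize (INR (S k)). intros r. simpl. rewrite Rinv_mult. unfold Rminus. ring. }
  exists (fun i => INR i * c i + -1 * (INR n * c i)). split; [|ring].
  apply (taylor_ext (fun u => u * (- INR k * (/ (u - p)) ^ S k)
                              + -1 * (INR n * (/ (u - p)) ^ k))
           _ (fun i => INR i * c i + -1 * (INR n * c i))).
  - intros u. ring.
  - trivial.
  - apply taylor_plus.
    + exact (taylor_euler _ _ _ Hc Hd).
    + apply taylor_scal, taylor_scal, Hc.
Qed.

(* [f = u W' - n W] with [W = a / (u-1)^2 + b / (u-1) + c / (u-S)^2 + d / (u-S)]. In the
   applications, [a], [b], [c], [d] come from matching polar parts at [u = 1] and [u = S]. *)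
Lemma taylor_euler_image (n : nat) (S a b c d : R) (f : R -> R) (cf : nat -> R) :
  S <> 0 -> taylor f cf ->
  locally 0 (fun u => f u =
    a * (- 2 * u / (u - 1) ^ 3 - INR n / (u - 1) ^ 2)
    + b * (- u / (u - 1) ^ 2 - INR n / (u - 1))
    + (c * (- 2 * u / (u - S) ^ 3 - INR n / (u - S) ^ 2)
       + d * (- u / (u - S) ^ 2 - INR n / (u - S)))) ->
  cf n = 0.
Proof.
  intros HS Hf E.
  destruct (inv_pow_euler_sub n 2 1 R1_neq_R0) as (c1 & H1 & E1).
  destruct (inv_pow_euler_sub n 1 1 R1_neq_R0) as (c2 & H2 & E2).
  destruct (inv_pow_euler_sub n 2 S HS) as (c3 & H3 & E3).
  destruct (inv_pow_euler_sub n 1 S HS) as (c4 & H4 & E4).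
  assert (H := taylor_plus _ _ _ _
    (taylor_plus _ _ _ _ (taylor_scal a _ _ H1) (taylor_scal b _ _ H2))
    (taylor_plus _ _ _ _ (taylor_scal c _ _ H3) (taylor_scal d _ _ H4))).
  rewrite (taylor_unique _ _ _ _ n Hf H).
  - rewrite E1, E2, E3, E4. ring.
  - revert E. apply filter_imp. intros u ->. unfold Rdiv.
    rewrite !pow_inv. simpl INR. rewrite !pow_1. ring.
Qed.

Section Identities.

Context (m n : nat) (y z : R) (Hm : m = (2 * n + 4)%nat)
  (Hy : 0 < y) (Hz : 0 < z) (Hy1 : y <> 1).

Let j := INR n + 1.

Lemma INR_m : INR m = 2 * j + 2.
Proof. rewrite Hm, plus_INR, mult_INR. unfold j. simpl. ring. Qed.

Lemma order_m : ((m - 4) / 2)%nat = n.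
Proof. rewrite Hm, Nat.add_sub, Nat.mul_comm. now apply Nat.div_mul. Qed.

Lemma K_Delta_taylor (s : R) :
  0 < s -> exists c, taylor (fun u => F m u s) c /\ K_Delta m s = INR (fact n) * c n.
Proof.
  intros Hs. destruct (F_taylor m s Hs) as [c Hc]. exists c. split; trivial.
  unfold K_Delta. rewrite order_m. now apply taylor_Derive_n.
Qed.

Lemma H_Delta_taylor (s t : R) :
  0 < s -> 0 < t ->
  exists c, taylor (fun u => G m u s t) c /\ H_Delta m s t = INR (fact n) * c n.
Proof.
  intros Hs Ht. destruct (G_taylor m s t Hs Ht) as [c Hc]. exists c. split; trivial.
  unfold H_Delta. rewrite order_m. now apply taylor_Derive_n.
Qed.

(* The last term is the coefficient of [F m (u / y^2) (z^2) / y^2]. *)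
Lemma K_H_relation :
  y * (y - 1) * (z - 1) * (y * z - 1) * H_Delta m (y ^ 2) (z ^ 2)
  + (y * z - 1) * (y * z - 2 * y + 1) * K_Delta m ((y * z) ^ 2)
  + (y - 1) ^ 2 * K_Delta m (y ^ 2)
  - (z - 1) ^ 2 * (/ y ^ 2) ^ S n * K_Delta m (z ^ 2) = 0.
Proof.
  assert (Hyz : 0 < y * z) by now apply Rmult_lt_0_compat.
  assert (HS : y ^ 2 <> 0) by now apply pow_nonzero, Rgt_not_eq.
  assert (Hp : (y * z) ^ 2 <> 0) by now apply pow_nonzero, Rgt_not_eq.
  destruct (H_Delta_taylor (y ^ 2) (z ^ 2)) as (c1 & H1 & ->); [now apply pow_lt..|].
  destruct (K_Delta_taylor ((y * z) ^ 2)) as (c2 & H2 & ->); [now apply pow_lt|].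
  destruct (K_Delta_taylor (y ^ 2)) as (c3 & H3 & ->); [now apply pow_lt|].
  destruct (K_Delta_taylor (z ^ 2)) as (c4 & H4 & ->); [now apply pow_lt|].
  assert (H := taylor_plus _ _ _ _
    (taylor_plus _ _ _ _
      (taylor_scal (y * (y - 1) * (z - 1) * (y * z - 1)) _ _ H1)
      (taylor_scal ((y * z - 1) * (y * z - 2 * y + 1)) _ _ H2))
    (taylor_plus _ _ _ _
      (taylor_scal ((y - 1) ^ 2) _ _ H3)
      (taylor_scal (- (z - 1) ^ 2 * / y ^ 2) _ _ (taylor_comp_scal (/ y ^ 2) _ _ H4)))).
  (* For generic [y] and [z] the poles at [(y * z) ^ 2] cancel, leaving those at 1 and [y ^ 2]. The
     coefficient [- k * y] is read off from the triple pole of the rescaled [F] at [y ^ 2]. *)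
  set (k := 2 * y * (z - 1) / INR m).
  apply (taylor_euler_image n (y ^ 2)
    (- k) (- k / (y - 1)) (- k * y) (k / (y - 1))) in H; trivial.
  - cbv beta in H. simpl pow in *.
    transitivity (INR (fact n) * 0); [rewrite <- H|]; ring.
  - generalize (filter_and _ _ (locally_0_neq 1 R1_neq_R0)
      (filter_and _ _ (locally_0_neq _ HS) (locally_0_neq _ Hp))).
    apply filter_imp. intros u (U1 & U2 & U3).
    (* [INR m = 2 * (j + 1)] stands in the denominators. *)
    assert (Hj : j + 1 <> 0) by (unfold j; pose proof (pos_INR n); lra).
    unfold k. rewrite G_sqr, !F_sqr, INR_m by trivial.
    replace (INR n) with (j - 1) by (unfold j; ring).
    field. repeat split; trivial; try lra.
Qed.

(** Here [z = / y], as in the term [H_D m s (- s)] of [T]; [K_H_relation] loses its [H_Delta] term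
    at this value. The fourth-order poles at 1 of the first two terms cancel, as do those at [y ^ 2]
    of the two rescaled terms, so that [taylor_euler_image] applies. *)
Lemma K_H_diagonal_relation :
  (y - 1) * H_Delta m (y ^ 2) ((/ y) ^ 2) + 2 * K_Delta m (1 ^ 2)
  + (/ y ^ 2) ^ S n * ((y - 1) / y ^ 2 * H_Delta m ((/ y) ^ 2) (y ^ 2)
                       - 2 / y * K_Delta m (1 ^ 2))
  - 2 * j * (y - 1) * K_Delta m (y ^ 2) = 0.
Proof.
  assert (HS : y ^ 2 <> 0) by now apply pow_nonzero, Rgt_not_eq.
  assert (Hy' : 0 < / y) by now apply Rinv_0_lt_compat.
  destruct (H_Delta_taylor (y ^ 2) ((/ y) ^ 2)) as (c1 & H1 & ->); [now apply pow_lt..|].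
  destruct (H_Delta_taylor ((/ y) ^ 2) (y ^ 2)) as (c2 & H2 & ->); [now apply pow_lt..|].
  destruct (K_Delta_taylor (1 ^ 2)) as (c3 & H3 & ->); [apply pow_lt; lra|].
  destruct (K_Delta_taylor (y ^ 2)) as (c4 & H4 & ->); [now apply pow_lt|].
  assert (H := taylor_plus _ _ _ _
    (taylor_plus _ _ _ _
      (taylor_plus _ _ _ _ (taylor_scal (y - 1) _ _ H1) (taylor_scal 2 _ _ H3))
      (taylor_scal (- 2 * j * (y - 1)) _ _ H4))
    (taylor_plus _ _ _ _
      (* The additional [/ y ^ 2] raises the power [n] produced by the rescaling of [u] to [S n]. *)
      (taylor_scal ((y - 1) * / y ^ 2 * / y ^ 2) _ _ (taylor_comp_scal (/ y ^ 2) _ _ H2))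
      (taylor_scal (- 2 / y * / y ^ 2) _ _ (taylor_comp_scal (/ y ^ 2) _ _ H3)))).
  (* [F] and [G] are O(u^-3) at infinity, which forces the residues of [W] to sum to zero: they are
     [b] and [- b]. *)
  set (b := (2 * y ^ 2 + 2 - 4 * j * (y - 1)) / (INR m * (y - 1) ^ 2 * (y + 1))).
  apply (taylor_euler_image n (y ^ 2)
    ((2 / (y - 1) - 4 * j) / INR m) b (2 * y ^ 2 / (INR m * (y - 1))) (- b)) in H; trivial.
  - cbv beta in H. transitivity (INR (fact n) * 0); [rewrite <- H|]; simpl; field; lra.
  - generalize (filter_and _ _ (locally_0_neq 1 R1_neq_R0) (locally_0_neq _ HS)).
    apply filter_imp. intros u [U1 U2].
    assert (Hj : j + 1 <> 0) by (unfold j; pose proof (pos_INR n); lra).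
    unfold b. rewrite !G_sqr, !F_sqr, INR_m by (trivial; lra).
    replace (INR n) with (j - 1) by (unfold j; ring).
    field. repeat split; trivial; try lra.
Qed.

End Identities.

(** * Extension by continuity *)

(** Properness of the trace filters is the form of density that makes limits along [D] unique. *)
Definition dense {X : UniformSpace} (D : X -> Prop) : Prop :=
  forall x, ProperFilter' (within D (locally x)).

Definition everywhere_continuous {X : UniformSpace} (f : X -> R) : Prop :=
  forall x, continuous f x.

Lemma fill_in {X : UniformSpace} (D : X -> Prop) (f : X -> R) (x : X) :
  D x -> fill D f x = f x.
Proof.
  intros H. unfold fill. now destruct (excluded_middle_informative (D x)).
Qed.

(** Outside [D], the value of the continuous [g] is a limit of [f] along [D], and by density the
    only one, so [iota] selects it. *)
Lemma fill_eq {X : UniformSpace} (D : X -> Prop) (f g : X -> R) (x : X) :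
  dense D -> everywhere_continuous g -> (forall x, D x -> f x = g x) ->
  fill D f x = g x.
Proof.
  intros HD Hg Hfg. unfold fill.
  destruct (excluded_middle_informative (D x)) as [H|_]; [now apply Hfg|].
  assert (HP : ProperFilter' (within D (locally x))) by apply HD.
  apply (iota_filterlim_locally (V := R_CompleteNormedModule)).
  apply filterlim_within_ext with g.
  - intros p Hp. symmetry. now apply Hfg.
  - apply filterlim_filter_le_1 with (2 := Hg x). now apply filter_le_within.
Qed.

Lemma continuous_eq_dense {X : UniformSpace} (D : X -> Prop) (f g : X -> R) (x : X) :
  dense D -> everywhere_continuous f -> everywhere_continuous g ->
  (forall x, D x -> f x = g x) -> f x = g x.
Proof.
  (* Both sides equal [fill D g x]. *)
  intros HD Hf Hg Hfg. rewrite <- (fill_eq D g g x), <- (fill_eq D g f x); trivial.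
  intros p Hp. symmetry. now apply Hfg.
Qed.

Lemma everywhere_continuous_fill {X : UniformSpace} (D : X -> Prop) (f g : X -> R) :
  dense D -> everywhere_continuous g -> (forall x, D x -> f x = g x) ->
  everywhere_continuous (fill D f).
Proof.
  intros HD Hg Hfg. replace (fill D f) with g; trivial.
  extensionality x. symmetry. now apply fill_eq.
Qed.

Lemma everywhere_continuous_fill_pair (D : R * R -> Prop) (f g : R * R -> R) :
  dense D -> everywhere_continuous g -> (forall p, D p -> f p = g p) ->
  everywhere_continuous (fun p => fill D f (fst p, snd p)).
Proof.
  intros HD Hg Hfg [s t]. apply continuous_ext with (fill D f); [now intros []|].
  now apply (everywhere_continuous_fill D f g).
Qed.

(** * Dense subsets of the line and the plane *)

Lemma at_right_0_neq (c : R) : at_right 0 (fun e => e <> c).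
Proof.
  apply locally_Rabs_lt. destruct (Rle_or_lt c 0) as [H|H].
  - exists 1. split; [lra|]. intros e _ He. lra.
  - exists c. split; trivial. intros e He He0 ->.
    rewrite Rminus_0_r, Rabs_pos_eq in He; lra.
Qed.

(** A path issuing from [x] and lying in [D] for small positive parameters meets every neighbourhood
    of [x] within [D]. *)
Lemma dense_path {X : UniformSpace} (D : X -> Prop) :
  (forall x, exists h : R -> X, h 0 = x /\ continuous h 0 /\ at_right 0 (fun e => D (h e))) ->
  dense D.
Proof.
  intros H x. destruct (H x) as (h & Hx & Hh & HD). constructor.
  - intros E. unfold within in E. rewrite <- Hx in E. apply Hh in E.
    unfold filtermap in E.
    apply (filter_not_empty (F := at_right 0)).
    assert (E' : at_right 0 (fun e => D (h e) -> False)) by (now apply filter_le_within).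
    generalize (filter_and _ _ HD E').
    apply filter_imp. intros e [H1 H2]. tauto.
  - apply within_filter, locally_filter.
Qed.

Lemma dense_neq_0 : dense (fun x : R => x <> 0).
Proof.
  apply dense_path. intros x. exists (fun e => x + e). split; [apply Rplus_0_r|]. split.
  - apply (continuous_plus (fun _ => x) (fun e => e));
        [apply continuous_const | apply continuous_id].
  - generalize (at_right_0_neq (- x)). apply filter_imp. intros e He E. apply He. lra.
Qed.

Lemma dense_prod (D : R * R -> Prop) :
  (forall s t, s <> 0 -> t <> 0 -> s + t <> 0 -> D (s, t)) -> dense D.
Proof.
  (* The diagonal direction is transverse to the three lines [s = 0], [t = 0] and [s + t = 0], so
     each is met for at most one [e]. *)
  intros H. apply dense_path. intros [s t]. exists (fun e => (s + e, t + e)).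
  split; [now rewrite !Rplus_0_r|]. split.
  - apply (continuous_comp_2 (fun e => s + e) (fun e => t + e) (fun x y => (x, y))).
    + apply (continuous_plus (fun _ => s) (fun e => e));
        [apply continuous_const | apply continuous_id].
    + apply (continuous_plus (fun _ => t) (fun e => e));
        [apply continuous_const | apply continuous_id].
    + apply continuous_ext with (fun p => p); [now intros []|]. apply continuous_id.
  - generalize (filter_and _ _ (at_right_0_neq (- s))
      (filter_and _ _ (at_right_0_neq (- t)) (at_right_0_neq (- (s + t) / 2)))).
    apply filter_imp. intros e (H1 & H2 & H3). apply H; lra.
Qed.

Lemma everywhere_continuous_comp {X Y : UniformSpace} (f : X -> Y) (g : Y -> R) :
  (forall x, continuous f x) -> everywhere_continuous g ->
  everywhere_continuous (fun x => g (f x)).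
Proof.
  intros Hf Hg x. apply continuous_comp; [apply Hf | apply Hg].
Qed.

Lemma everywhere_continuous_comp_2 {X : UniformSpace} (f g : X -> R) (q : R * R -> R) :
  everywhere_continuous f -> everywhere_continuous g -> everywhere_continuous q ->
  everywhere_continuous (fun x => q (f x, g x)).
Proof.
  intros Hf Hg Hq x. apply (continuous_comp_2 f g (fun a b => q (a, b))); trivial.
  apply continuous_ext with q; [now intros []|]. apply Hq.
Qed.

Lemma everywhere_continuous_algebra (X : UniformSpace) :
  exp_algebra (@everywhere_continuous X).
Proof.
  constructor.
  - intros a x. apply continuous_const.
  - intros f g Hf Hg x. exact (continuous_plus f g x (Hf x) (Hg x)).
  - intros f g Hf Hg x. exact (continuous_mult f g x (Hf x) (Hg x)).
  - intros f Hf. apply everywhere_continuous_comp; trivial. intros x. apply continuous_exp.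
Qed.

(* Differentiability in Carathéodory's form, uniformly on R: the difference
   quotient extends to a jointly continuous function. *)
Definition slope (f : R -> R) (q : R * R -> R) : Prop :=
  everywhere_continuous q /\ forall x y, f x - f y = (x - y) * q (x, y).

Definition has_slope (f : R -> R) : Prop := exists q, slope f q.

Lemma slope_continuous (f : R -> R) (q : R * R -> R) :
  slope f q -> everywhere_continuous f.
Proof.
  intros [Hq H]. replace f with (fun x => f 0 + x * q (x, 0)).
  - apply (alg_plus _ (everywhere_continuous_algebra _)).
    + intros x. apply continuous_const.
    + apply (alg_mult _ (everywhere_continuous_algebra _)).
      * intros x. apply continuous_id.
      * apply everywhere_continuous_comp_2; trivial; intros x;
          [apply continuous_id | apply continuous_const].
  - extensionality x. specialize (H x 0). lra.
Qed.

(** On the diagonal the quotient is completed by the derivative. By the mean value theorem each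
    value of [q] is a value of [g] between the two arguments, whence continuity at the diagonal;
    elsewhere [q] is locally a quotient of continuous functions. *)
Lemma slope_C1 (f g : R -> R) :
  (forall x, is_derive f x (g x)) -> everywhere_continuous g -> has_slope f.
Proof.
  intros Hf Hg.
  assert (Hc : everywhere_continuous f).
  { intros x. apply (ex_derive_continuous (V := R_NormedModule)). now exists (g x). }
  set (q := fun p : R * R => if Req_EM_T (fst p) (snd p) then g (fst p)
                             else (f (fst p) - f (snd p)) / (fst p - snd p)).
  assert (MVT : forall x y, exists c, Rmin y x <= c <= Rmax y x /\ q (x, y) = g c).
  { intros x y. unfold q. simpl. destruct (Req_EM_T x y) as [<-|Hxy].
    - exists x. split; trivial. rewrite Rmin_left, Rmax_left; lra.
    - destruct (MVT_gen f y x g) as (c & Hcxy & E).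
      + intros c _. apply Hf.
      + intros c _. apply continuity_pt_filterlim, Hc.
      + exists c. split; trivial. rewrite E. field. lra. }
  exists q. split.
  - intros [x y]. destruct (Req_EM_T x y) as [<-|Hxy].
    + apply filterlim_locally. intros eps.
      assert (H := proj1 (filterlim_locally _ _) (Hg x) eps).
      apply locally_Rabs_lt in H. destruct H as (r & Hr & H).
      replace (q (x, x)) with (g x).
      2: { unfold q. simpl. now destruct (Req_EM_T x x). }
      exists (mkposreal r Hr). intros [x' y'] [H1 H2].
      destruct (MVT x' y') as (c & Hcxy & E).
      assert (B : ball (g x) eps (g c)); [apply H|rewrite <- E in B; exact B].
      change (Rabs (x' - x) < r) in H1. change (Rabs (y' - x) < r) in H2.
      apply Rabs_def2 in H1, H2. apply Rabs_def1;
      revert Hcxy; unfold Rmin, Rmax; destruct (Rle_dec y' x'); lra.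
    + apply continuous_ext_loc with
        (fun p => (f (fst p) - f (snd p)) * / (fst p - snd p)).
      (* Moving each coordinate by less than half the distance keeps them distinct. *)
      * assert (Hd : 0 < Rabs (x - y) / 2) by (apply Rdiv_lt_0_compat; [apply Rabs_pos_lt|]; lra).
        exists (mkposreal _ Hd). intros [x' y'] [H1 H2].
        change (Rabs (x' - x) < Rabs (x - y) / 2) in H1.
        change (Rabs (y' - y) < Rabs (x - y) / 2) in H2.
        unfold q. simpl. destruct (Req_EM_T x' y') as [->|]; [|reflexivity].
        exfalso. revert H1 H2. unfold Rabs.
        destruct (Rcase_abs (y' - x)), (Rcase_abs (y' - y)), (Rcase_abs (x - y)); lra.
      * apply (continuous_mult (fun p : R * R => f (fst p) - f (snd p))
                 (fun p => / (fst p - snd p))).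
        -- apply (continuous_minus (fun p : R * R => f (fst p)) (fun p => f (snd p)));
             (apply continuous_comp; [|apply Hc]);
             [apply continuous_fst | apply continuous_snd].
        -- apply (continuous_comp (fun p : R * R => fst p - snd p) Rinv);
             [|apply continuous_Rinv; simpl; lra].
           apply (continuous_minus (fun p : R * R => fst p) (fun p => snd p));
             [apply continuous_fst | apply continuous_snd].
  - intros x y. unfold q. simpl. destruct (Req_EM_T x y) as [<-|]; [ring|]. field. lra.
Qed.

Lemma has_slope_id : has_slope (fun x => x).
Proof.
  exists (fun _ => 1). split; [intros x; apply continuous_const | intros; ring].
Qed.

Lemma has_slope_comp (f g : R -> R) :
  has_slope f -> has_slope g -> has_slope (fun x => g (f x)).
Proof.
  intros [p Hp] [q Hq].
  exists (fun xy => p xy * q (f (fst xy), f (snd xy))). split.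
  - apply (alg_mult _ (everywhere_continuous_algebra _)); [apply Hp|].
    apply everywhere_continuous_comp_2; [| |apply Hq];
      (apply everywhere_continuous_comp; [|now apply slope_continuous with p]);
      intros []; [apply continuous_fst | apply continuous_snd].
  - intros x y. simpl. destruct Hp as [_ Hp], Hq as [_ Hq]. rewrite Hq, Hp. ring.
Qed.

Lemma has_slope_algebra : exp_algebra has_slope.
Proof.
  assert (A := everywhere_continuous_algebra (prod_UniformSpace R_UniformSpace R_UniformSpace)).
  constructor.
  - intros a. exists (fun _ => 0). split; [intros x; apply continuous_const | intros; ring].
  - intros f g [p [Hp1 Hp2]] [q [Hq1 Hq2]]. exists (fun xy => p xy + q xy). split.
    + now apply (alg_plus _ A).
    + intros x y. rewrite Rmult_plus_distr_l, <- Hp2, <- Hq2. ring.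
  - intros f g [p Hp] [q Hq].
    exists (fun xy => p xy * g (fst xy) + f (snd xy) * q xy). split.
    + apply (alg_plus _ A); apply (alg_mult _ A); try apply Hp; try apply Hq;
        (apply everywhere_continuous_comp; [intros []|]).
      * apply continuous_fst.
      * now apply slope_continuous with q.
      * apply continuous_snd.
      * now apply slope_continuous with p.
    + intros x y. simpl. destruct Hp as [_ Hp], Hq as [_ Hq].
      replace (f x * g x - f y * g y) with ((f x - f y) * g x + f y * (g x - g y)) by ring.
      rewrite Hp, Hq. ring.
  - intros f Hf. apply has_slope_comp; trivial. apply slope_C1 with exp.
    + apply is_derive_exp.
    + intros x. apply continuous_exp.
Qed.

(** * Continuity of the difference quotients of T *)

(** The coefficients of [exp]. One shift gives [f1], a second gives [g2 x (- x)], so both are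
    entire. *)
Definition exp_coef (n : nat) : R := / INR (fact n).

Lemma CV_radius_exp : CV_radius exp_coef = p_infty.
Proof.
  assert (H : forall x : R, Rbar_le (Rabs x) (CV_radius exp_coef)).
  { intros x. apply CV_radius_ge. exists (exp x). apply is_exp_Reals. }
  destruct (CV_radius exp_coef) as [r| |]; trivial.
  - specialize (H (Rabs r + 1)). simpl in H.
    assert (Hr := Rle_abs r). assert (Hr' := Rabs_pos r). rewrite Rabs_pos_eq in H; lra.
  - now specialize (H 0).
Qed.

Lemma has_slope_PSeries (a : nat -> R) :
  CV_radius a = p_infty -> has_slope (PSeries a).
Proof.
  intros Ha. apply slope_C1 with (PSeries (PS_derive a)); intros x.
  - apply is_derive_PSeries. now rewrite Ha.
  - apply (ex_derive_continuous (V := R_NormedModule)), ex_derive_PSeries.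
    now rewrite CV_radius_derive, Ha.
Qed.

Lemma PSeries_decr_1_mult (a : nat -> R) (x : R) :
  CV_radius a = p_infty -> x * PSeries (PS_decr_1 a) x = PSeries a x - a O.
Proof.
  intros Ha. rewrite (PSeries_decr_1 a).
  - ring.
  - apply CV_radius_inside. now rewrite Ha.
Qed.

Lemma f1_PSeries (x : R) : f1 x = PSeries (PS_decr_1 exp_coef) x.
Proof.
  apply (fill_eq _ _ (PSeries (PS_decr_1 exp_coef))).
  - apply dense_neq_0.
  - destruct (has_slope_PSeries (PS_decr_1 exp_coef)) as [q Hq].
    + now rewrite CV_radius_decr_1, CV_radius_exp.
    + now apply slope_continuous with q.
  - clear x. intros x Hx. apply Rmult_eq_reg_l with x; trivial.
    rewrite PSeries_decr_1_mult by exact CV_radius_exp.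
    rewrite (is_pseries_unique exp_coef x (exp x) (is_exp_Reals x)).
    unfold exp_coef. simpl. field. trivial.
Qed.

Lemma f1_neq_0 (x : R) : x <> 0 -> f1 x = (exp x - 1) / x.
Proof. apply (fill_in (fun x : R => x <> 0) (fun x => (exp x - 1) / x)). Qed.

Lemma f1_0 : f1 0 = 1.
Proof.
  rewrite f1_PSeries, PSeries_0. unfold PS_decr_1, exp_coef. simpl. field.
Qed.

Lemma has_slope_f1 : has_slope f1.
Proof.
  replace f1 with (PSeries (PS_decr_1 exp_coef)).
  - apply has_slope_PSeries. now rewrite CV_radius_decr_1, CV_radius_exp.
  - extensionality x. symmetry. apply f1_PSeries.
Qed.

Lemma everywhere_continuous_f1 : everywhere_continuous f1.
Proof. destruct has_slope_f1 as [q Hq]. now apply slope_continuous with q. Qed.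

Lemma dense_snd_neq_0 : dense (fun p : R * R => snd p <> 0).
Proof. now apply dense_prod. Qed.

Lemma dense_fst_snd_neq_0 : dense (fun p : R * R => fst p <> 0 /\ snd p <> 0).
Proof. now apply dense_prod. Qed.

Lemma dense_sum_neq_0 : dense (fun p : R * R => fst p + snd p <> 0).
Proof. now apply dense_prod. Qed.

Lemma everywhere_continuous_fst : everywhere_continuous (fun p : R * R => fst p).
Proof. intros []. apply continuous_fst. Qed.

Lemma everywhere_continuous_snd : everywhere_continuous (fun p : R * R => snd p).
Proof. intros []. apply continuous_snd. Qed.

(** [g2 x y] is the slope of [f1] at [(x + y, x)]. *)
Lemma everywhere_continuous_g2 : everywhere_continuous (fun p : R * R => g2 (fst p) (snd p)).
Proof.
  destruct has_slope_f1 as [q [Hq H]].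
  assert (Hc : everywhere_continuous (fun p : R * R => q (fst p + snd p, fst p))).
  { apply everywhere_continuous_comp_2; trivial; [|exact everywhere_continuous_fst].
    apply (alg_plus _ (everywhere_continuous_algebra _));
      [exact everywhere_continuous_fst | exact everywhere_continuous_snd]. }
  apply (everywhere_continuous_fill_pair _ _ (fun p => q (fst p + snd p, fst p)));
    [exact dense_snd_neq_0 | exact Hc |].
  intros [x y] Hy. simpl in *. rewrite H. field. trivial.
Qed.

(** Since [f1 0 = 1], the quotient is [(f1 x - 1) / x]. Continuity of [g2] alone would not give the
    slope that [T] requires. *)
Lemma g2_opp (x : R) : g2 x (- x) = PSeries (PS_decr_1 (PS_decr_1 exp_coef)) x.
Proof.
  apply (continuous_eq_dense (fun x => x <> 0) (fun x => g2 x (- x))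
           (PSeries (PS_decr_1 (PS_decr_1 exp_coef)))).
  - exact dense_neq_0.
  - apply (everywhere_continuous_comp_2 (fun x => x) Ropp (fun p => g2 (fst p) (snd p))).
    + intros y. apply continuous_id.
    + intros y. apply (continuous_opp (V := R_NormedModule) (fun x : R => x)), continuous_id.
    + exact everywhere_continuous_g2.
  - destruct (has_slope_PSeries (PS_decr_1 (PS_decr_1 exp_coef))) as [q Hq].
    + now rewrite !CV_radius_decr_1, CV_radius_exp.
    + now apply slope_continuous with q.
  - clear x. intros x Hx. unfold g2. rewrite fill_in by (simpl; lra). simpl.
    apply Rmult_eq_reg_l with x; trivial.
    rewrite PSeries_decr_1_mult by now rewrite CV_radius_decr_1, CV_radius_exp.
    rewrite <- f1_PSeries, Rplus_opp_r, f1_0. unfold PS_decr_1, exp_coef. simpl.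
    field. trivial.
Qed.

Lemma has_slope_T (m : nat) : has_slope (T m).
Proof.
  assert (A := has_slope_algebra). assert (I := has_slope_id).
  assert (Hlin : forall c, has_slope (fun x => x * c)).
  { intros c. apply (alg_mult _ A); trivial. apply (alg_const _ A). }
  assert (Hf1 : forall c, has_slope (fun x => f1 (x * c))).
  { intros c. apply has_slope_comp; [apply Hlin | exact has_slope_f1]. }
  (* On the antidiagonal the prefactor is [exp 0] and [K_Delta] is taken at the constant 1.
     Arguments are put in the form [x * c] of [Hlin] and [Hf1]. *)
  replace (T m) with (fun x => 2 * j0 m * K_D m 0 * f1 (x * - j0 m)
    + (exp (x * / 2) * H_Delta m (exp x) (exp (x * -1)) * f1 (x * / 2) * f1 (x * - / 2)
       + 2 * PSeries (PS_decr_1 (PS_decr_1 exp_coef)) (x * / 2) * K_Delta m 1)).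
  - repeat first [ apply Hf1 | apply (alg_const _ A) | apply (alg_plus _ A)
                 | apply (alg_exp _ A) | apply (alg_H_Delta _ A) | apply Hlin | exact I
                 | apply (alg_mult _ A) ].
    apply has_slope_comp; [apply Hlin|]. apply has_slope_PSeries.
    now rewrite !CV_radius_decr_1, CV_radius_exp.
  - extensionality x. unfold T, H_D. rewrite <- g2_opp.
    replace (x + - x) with 0 by ring.
    replace (- x / 2) with (- (x * / 2)) by field.
    replace (x * - / 2) with (- (x * / 2)) by field.
    replace (x * -1) with (- x) by ring.
    replace (0 / 4) with 0 by field. rewrite exp_0, (Rmult_comm x (- j0 m)).
    unfold Rdiv. ring.
Qed.

Lemma has_slope_Ttilde (m : nat) : has_slope (Ttilde m).
Proof.
  assert (A := has_slope_algebra).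
  apply (alg_mult _ A).
  - apply (has_slope_comp Ropp); [|apply has_slope_T].
    replace Ropp with (fun x => -1 * x) by (extensionality x; ring).
    apply (alg_mult _ A); [apply (alg_const _ A) | apply has_slope_id].
  - apply (alg_exp _ A), (alg_mult _ A); [apply (alg_const _ A) | apply has_slope_id].
Qed.

(** * The local curvature identities *)

Ltac continuity_alg :=
  lazymatch goal with
  | |- everywhere_continuous (fun _ => ?a) =>
      exact (alg_const _ (everywhere_continuous_algebra _) a)
  | |- everywhere_continuous (fun x => @?f x + @?g x) =>
      apply (alg_plus _ (everywhere_continuous_algebra _) f g); continuity_alg
  | |- everywhere_continuous (fun x => @?f x * @?g x) =>
      apply (alg_mult _ (everywhere_continuous_algebra _) f g); continuity_alg
  | |- everywhere_continuous (fun x => exp (@?f x)) =>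
      apply (alg_exp _ (everywhere_continuous_algebra _) f); continuity_alg
  | |- everywhere_continuous (fun x => f1 (@?f x)) =>
      apply (everywhere_continuous_comp f f1); [|exact everywhere_continuous_f1];
      change (everywhere_continuous f); continuity_alg
  | |- everywhere_continuous (fun x => g2 (@?f x) (@?g x)) =>
      apply (everywhere_continuous_comp_2 f g (fun p => g2 (fst p) (snd p)));
      [| |exact everywhere_continuous_g2]; continuity_alg
  | |- everywhere_continuous (fun x => K_Delta ?m (exp (@?f x))) =>
      apply (alg_K_Delta _ (everywhere_continuous_algebra _) m f); continuity_alg
  | |- everywhere_continuous (fun x => H_Delta ?m (exp (@?f x)) (exp (@?g x))) =>
      apply (alg_H_Delta _ (everywhere_continuous_algebra _) m f g); continuity_alg
  | H : everywhere_continuous ?h |- everywhere_continuous (fun x => ?h (@?f x, @?g x)) =>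
      apply (everywhere_continuous_comp_2 f g h); [| |exact H]; continuity_alg
  | H : everywhere_continuous ?h |- everywhere_continuous (fun x => ?h (@?f x)) =>
      apply (everywhere_continuous_comp f h); [|exact H];
      change (everywhere_continuous f); continuity_alg
  | |- everywhere_continuous (fun x => fst x) => exact everywhere_continuous_fst
  | |- everywhere_continuous (fun x => snd x) => exact everywhere_continuous_snd
  | |- everywhere_continuous (fun x => x) => intros ?; apply continuous_id
  end.

(** The right-hand side is continuous at 0 as well, and supplies the extensions of [K_EH] and
    [H_EH]. *)
Lemma sinh_div (x : R) : x <> 0 -> sinh (x / 4) / x = exp (- / 4 * x) * f1 (x * / 2) * / 4.
Proof.
  intros Hx. rewrite f1_neq_0 by lra. unfold sinh.
  replace (exp (x * / 2)) with (exp (x / 4) * exp (x / 4))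
    by (rewrite <- exp_plus; f_equal; field).
  replace (- / 4 * x) with (- (x / 4)) by field.
  assert (H : exp (- (x / 4)) * exp (x / 4) = 1).
  { rewrite <- exp_plus, <- exp_0. f_equal. ring. }
  apply Rmult_eq_reg_l with x; trivial.
  replace (x * (exp (- (x / 4)) * ((exp (x / 4) * exp (x / 4) - 1) / (x * / 2)) * / 4))
    with ((exp (- (x / 4)) * exp (x / 4) * exp (x / 4) - exp (- (x / 4))) / 2)
    by (field; trivial).
  rewrite H. field. trivial.
Qed.

Lemma everywhere_continuous_K_EH (m : nat) : everywhere_continuous (K_EH m).
Proof.
  apply everywhere_continuous_fill with (fun s =>
    -8 * j0 m * (exp (- / 4 * s) * f1 (s * / 2) * / 4)
    * (exp (s * / 4) * K_Delta m (exp s) * f1 (s * / 2))).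
  - exact dense_neq_0.
  - continuity_alg.
  - intros s Hs. now rewrite sinh_div.
Qed.

Lemma everywhere_continuous_H_EH (m : nat) :
  everywhere_continuous (fun p => H_EH m (fst p) (snd p)).
Proof.
  unfold H_EH.
  apply everywhere_continuous_fill_pair with (fun p : R * R =>
    -8 * j0 m * (exp (- / 4 * (fst p + snd p)) * f1 ((fst p + snd p) * / 2) * / 4)
    * (exp ((fst p + snd p) * / 4)
       * (exp (fst p * / 2) * H_Delta m (exp (fst p)) (exp (snd p))
          * f1 (fst p * / 2) * f1 (snd p * / 2)
          + 2 * g2 (fst p * / 2) (snd p * / 2) * K_Delta m (exp (fst p + snd p))))).
  - exact dense_sum_neq_0.
  - continuity_alg.
  - intros [s t] Hst. now rewrite sinh_div.
Qed.

Lemma everywhere_continuous_L (m : nat) :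
  everywhere_continuous (fun p => L m (fst p) (snd p)).
Proof.
  destruct (has_slope_T m) as [q Hq]. apply slope_continuous in Hq.
  unfold L. continuity_alg.
Qed.

Lemma everywhere_continuous_M (m : nat) :
  everywhere_continuous (fun p => M m (fst p) (snd p)).
Proof.
  destruct (has_slope_T m) as [q [Hq H]].
  unfold M.
  apply everywhere_continuous_fill_pair with (fun p : R * R =>
    2 * exp (- j0 m * (fst p + snd p))
    (* The factor [-1] comes from [(- t) - s = - (s + t)]. *)
    * (-1 * q (-1 * snd p, fst p) + q (snd p, -1 * fst p) * exp (j0 m * snd p))).
  - exact dense_sum_neq_0.
  - continuity_alg.
  - intros [s t] Hst. simpl in *. rewrite !H.
    replace (-1 * s) with (- s) by ring. replace (-1 * t) with (- t) by ring.
    field. trivial.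
Qed.

(** The common form of [P] and [Q], with [f] being [T] or [Ttilde]; the slope of [f] replaces both
    quotients. *)
Lemma everywhere_continuous_double_quotient (j : R) (f : R -> R) : has_slope f ->
  everywhere_continuous (fun p => fill (fun p : R * R => fst p <> 0 /\ snd p <> 0)
    (fun p : R * R => let (s, t) := p in
       - 2 * j * f1 (- j * s) * f t - 2 * ((f (s + t) - f t) / s)
       + 2 * ((f (s + t) - f s) / t)) (fst p, snd p)).
Proof.
  intros [q Hq]. assert (Hf := slope_continuous _ _ Hq). destruct Hq as [Hq H].
  apply everywhere_continuous_fill_pair with (fun p : R * R =>
    - 2 * j * f1 (- j * fst p) * f (snd p) + -2 * q (fst p + snd p, snd p)
    + 2 * q (fst p + snd p, fst p)).
  - exact dense_fst_snd_neq_0.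
  - continuity_alg.
  - intros [s t] [Hs Ht]. simpl in *. rewrite !H. field. tauto.
Qed.

Lemma everywhere_continuous_P (m : nat) :
  everywhere_continuous (fun p => P m (fst p) (snd p)).
Proof. exact (everywhere_continuous_double_quotient (j0 m) _ (has_slope_T m)). Qed.

Lemma everywhere_continuous_Q (m : nat) :
  everywhere_continuous (fun p => Q m (fst p) (snd p)).
Proof. exact (everywhere_continuous_double_quotient (j0 m) _ (has_slope_Ttilde m)). Qed.

(** * The identities away from the singular lines *)

Section GenericIdentities.

Context (m n : nat) (Hm : m = (2 * n + 4)%nat).

Let j := INR n + 1.

Lemma j0_eq : j0 m = j.
Proof. unfold j0. rewrite (INR_m m n Hm). fold j. field. Qed.

Lemma j_neq_0 : j <> 0.
Proof. unfold j. pose proof (pos_INR n). lra. Qed.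

(** As [j = n + 1], this is the rescaling factor occurring in both relations. *)
Lemma exp_neg_j (s : R) : exp (- j * s) = (/ exp (s / 2) ^ 2) ^ S n.
Proof.
  rewrite exp_half_pow2, <- exp_Ropp. unfold j. rewrite <- S_INR.
  generalize (S n). intros k. induction k as [|k IH].
  - simpl. rewrite <- exp_0. f_equal. ring.
  - rewrite S_INR. simpl pow. rewrite <- IH, <- exp_plus. f_equal. ring.
Qed.

Lemma exp_half_neq_1 (s : R) : s <> 0 -> exp (s / 2) <> 1.
Proof.
  intros Hs E. apply Hs. rewrite <- exp_0 in E. apply exp_inv in E. lra.
Qed.

(** Absorbs the quarter exponentials, leaving only [exp (x / 2)]. *)
Lemma exp_mult_sinh (x : R) : exp (x / 4) * sinh (x / 4) = (exp (x / 2) - 1) / 2.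
Proof.
  unfold sinh, Rdiv. rewrite <- Rmult_assoc, Rmult_minus_distr_l, <- !exp_plus.
  rewrite Rplus_opp_r, exp_0. do 3 f_equal. field.
Qed.

Lemma K_EH_neq_0 (s : R) : s <> 0 ->
  K_EH m s = - 8 * j * (exp (s / 2) - 1) ^ 2 * K_Delta m (exp (s / 2) ^ 2) / s ^ 2.
Proof.
  intros Hs. unfold K_EH. rewrite fill_in by trivial.
  unfold K_D. rewrite j0_eq, f1_neq_0, exp_half_pow2 by lra.
  replace (-8 * j * (sinh (s / 4) / s)
           * (exp (s / 4) * K_Delta m (exp s) * ((exp (s / 2) - 1) / (s / 2))))
    with (-16 * j * (exp (s / 4) * sinh (s / 4)) * K_Delta m (exp s) * (exp (s / 2) - 1) / s ^ 2)
    by (field; trivial).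
  rewrite exp_mult_sinh. field. trivial.
Qed.

(** The [K_D m 0] terms cancel the parts of order [1 / s] that come from [g2]; what remains is a
    multiple of [K_H_diagonal_relation]. *)
Lemma K_EH_generic (s : R) : s <> 0 -> K_EH m s = - (T m s + Ttilde m s).
Proof.
  intros Hs. assert (Hj := j_neq_0).
  assert (Hjs : j * s <> 0) by now apply Rmult_integral_contrapositive.
  assert (R := K_H_diagonal_relation m n (exp (s / 2)) Hm (exp_pos _) (exp_half_neq_1 s Hs)).
  rewrite K_EH_neq_0 by trivial. unfold Ttilde, T, H_D, K_D, g2.
  rewrite j0_eq, !fill_in by (simpl; lra). cbn [fst snd].
  replace (s + - s) with 0 by ring. replace (- s + - - s) with 0 by ring.
  replace (s / 2 + - s / 2) with 0 by field. replace (- s / 2 + - - s / 2) with 0 by field.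
  replace (- - s) with s by ring. replace (0 / 4) with 0 by field. replace (0 / 2) with 0 by field.
  rewrite f1_0, exp_0, !f1_neq_0 by lra.
  replace (- s / 2) with (- (s / 2)) in * by field.
  replace (- j * - s) with (- (- j * s)) by ring.
  rewrite <- (exp_half_pow2 s), <- (exp_half_pow2 (- s)).
  replace (- s / 2) with (- (s / 2)) in * by field.
  rewrite !(exp_Ropp (s / 2)), (exp_Ropp (- j * s)).
  rewrite <- exp_neg_j in R. fold j in R. rewrite pow1 in R.
  assert (Hy := exp_pos (s / 2)). assert (HX := exp_pos (- j * s)).
  set (y := exp (s / 2)) in *. set (X := exp (- j * s)) in *.
  generalize dependent (H_Delta m (y ^ 2) ((/ y) ^ 2)). intros H1.
  generalize dependent (H_Delta m ((/ y) ^ 2) (y ^ 2)). intros H2.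
  generalize dependent (K_Delta m (y ^ 2)). intros K1.
  generalize dependent (K_Delta m 1). intros K2 R.
  clearbody X y. apply Rminus_diag_uniq.
  match type of R with ?r = 0 => transitivity (4 * (y - 1) / s ^ 2 * r) end.
  - field. repeat split; lra.
  - rewrite R. ring.
Qed.

(** The one-variable identity at [s], [t] and [s + t] trades [T] at these points for [K_Delta] and
    [T] at the opposite points. The latter values cancel, and a multiple of [K_H_relation] is
    left. *)
Lemma H_EH_generic (s t : R) : s <> 0 -> t <> 0 -> s + t <> 0 ->
  H_EH m s t = L m s t + M m s t - P m s t - Q m s t.
Proof.
  intros Hs Ht Hst. assert (Hj := j_neq_0).
  assert (Hjs : j * s <> 0) by now apply Rmult_integral_contrapositive.
  assert (Hjst : j * (s + t) <> 0) by now apply Rmult_integral_contrapositive.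
  assert (R := K_H_relation m n (exp (s / 2)) (exp (t / 2)) Hm (exp_pos _) (exp_pos _)
                 (exp_half_neq_1 s Hs)).
  rewrite <- exp_neg_j, <- exp_plus in R.
  assert (Es := K_EH_generic s Hs). assert (Et := K_EH_generic t Ht).
  assert (Est := K_EH_generic (s + t) Hst).
  rewrite K_EH_neq_0 in Es, Et, Est by trivial.
  unfold H_EH, L, M, P, Q, H_D, g2. rewrite !fill_in by (simpl; lra). cbn [fst snd].
  unfold Ttilde in *. rewrite j0_eq in *. rewrite !f1_neq_0 by lra.
  replace (s / 2 + t / 2) with ((s + t) / 2) in * by field.
  replace (exp (- j * (s + t))) with (exp (- j * s) * exp (- j * t)) in *
    by (rewrite <- exp_plus; f_equal; ring).
  replace (exp (j * t)) with (/ exp (- j * t)) by (rewrite <- exp_Ropp; f_equal; ring).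
  (* Brings the prefactor of [H_D] next to [sinh], as [exp_mult_sinh] requires. *)
  match goal with |- ?a * ?b * (?e * ?c) = ?r =>
    replace (a * b * (e * c)) with (a * (e * sinh ((s + t) / 4)) / (s + t) * c)
      by (unfold Rdiv; ring) end.
  rewrite exp_mult_sinh.
  rewrite <- (exp_half_pow2 s), <- (exp_half_pow2 t), <- (exp_half_pow2 (s + t)).
  assert (Ew : exp ((s + t) / 2) = exp (s / 2) * exp (t / 2))
    by (rewrite <- exp_plus; f_equal; field).
  rewrite Ew in *.
  assert (HY := exp_pos (- j * t)).
  replace (T m s) with (- (-8 * j * (exp (s / 2) - 1) ^ 2 * K_Delta m (exp (s / 2) ^ 2) / s ^ 2)
                        - T m (- s) * exp (- j * s)) by (rewrite Es; ring).
  replace (T m t) with (- (-8 * j * (exp (t / 2) - 1) ^ 2 * K_Delta m (exp (t / 2) ^ 2) / t ^ 2)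
                        - T m (- t) * exp (- j * t)) by (rewrite Et; ring).
  match type of Est with ?e = - (_ + ?r) =>
    replace (T m (s + t)) with (- e - r) by (rewrite Est; ring) end.
  set (y := exp (s / 2)) in *. set (z := exp (t / 2)) in *.
  set (X := exp (- j * s)) in *. set (Y := exp (- j * t)) in *.
  clear Es Et Est Ew. clearbody X Y y z.
  generalize dependent (H_Delta m (y ^ 2) (z ^ 2)). intros H1.
  generalize dependent (K_Delta m (y ^ 2)). intros K1.
  generalize dependent (K_Delta m (z ^ 2)). intros K2.
  generalize dependent (K_Delta m ((y * z) ^ 2)). intros K3 R.
  generalize (T m (- s)) (T m (- t)) (T m (- (s + t))). intros T1 T2 T3.
  apply Rminus_diag_uniq.
  (* The multiplier is read off from the coefficient of [H_Delta]. *)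
  match type of R with ?r = 0 => transitivity (-16 * j / (s * t * (s + t)) * r) end.
  - field. repeat split; trivial; lra.
  - rewrite R. ring.
Qed.

End GenericIdentities.

Theorem theorem4p1 (m : nat) (hm : (4 <= m)%nat) (hev : Nat.Even m) :
  (forall s : R, K_EH m s = - (T m s + Ttilde m s)) /\
  (forall s t : R, H_EH m s t = L m s t + M m s t - P m s t - Q m s t).
Proof.
  destruct hev as [k Hk].
  (* The order of differentiation is [n = k - 2]; the subtraction is exact since [4 <= m]. *)
  assert (Hm : m = (2 * (k - 2) + 4)%nat) by lia.
  split.
  - intros s. apply (continuous_eq_dense (fun s => s <> 0) (K_EH m)
      (fun s => - (T m s + Ttilde m s))).
    + exact dense_neq_0.
    + apply everywhere_continuous_K_EH.
    + destruct (has_slope_T m) as [q Hq]. apply slope_continuous in Hq.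
      destruct (has_slope_Ttilde m) as [q' Hq']. apply slope_continuous in Hq'.
      intros x. apply (continuous_opp (V := R_NormedModule) (fun s => T m s + Ttilde m s)).
      apply (continuous_plus (T m) (Ttilde m)); trivial.
    + exact (K_EH_generic m _ Hm).
  - intros s t. apply (continuous_eq_dense
      (fun p : R * R => fst p <> 0 /\ snd p <> 0 /\ fst p + snd p <> 0)
      (fun p => H_EH m (fst p) (snd p))
      (fun p => L m (fst p) (snd p) + M m (fst p) (snd p)
                - P m (fst p) (snd p) - Q m (fst p) (snd p)) (s, t)).
    + now apply dense_prod.
    + apply everywhere_continuous_H_EH.
    + intros p.
      apply (continuous_minus (V := R_NormedModule)
        (fun p => L m (fst p) (snd p) + M m (fst p) (snd p) - P m (fst p) (snd p)));
        [|apply everywhere_continuous_Q].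
      apply (continuous_minus (V := R_NormedModule)
        (fun p => L m (fst p) (snd p) + M m (fst p) (snd p)));
        [|apply everywhere_continuous_P].
      apply (continuous_plus (fun p => L m (fst p) (snd p)));
        [apply everywhere_continuous_L | apply everywhere_continuous_M].
    + intros [x y] (Hx & Hy & Hxy). now apply (H_EH_generic m _ Hm).
Qed.
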